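(* Let $D$ be a subset of $\mathbb{R}$, $N$ a nonnegative integer, and $a_{\alpha,\beta}\in\mathbb{C}$ for $\alpha\in D$, $\beta=0,\dots,N$. Then the series $$\sum_{\alpha\in D}a_{\alpha,\beta}z^\alpha$$ for $\beta=0,\dots,N$ are all absolutely convergent on some (nonempty) open subset of $\mathbb{C}^\times$ if and only if the series $$\sum_{\alpha\in D}\left(\sum_{\beta=0}^{N}a_{\alpha,\beta}(\log z)^\beta\right)z^\alpha$$ and the corresponding series of first and higher derivatives with respect to $z$, viewed as series whose terms are the expressions $\left(\sum_{\beta=0}^{N}a_{\alpha,\beta}(\log z)^\beta\right)z^\alpha$ and their derivatives with respect to $z$, are absolutely convergent on the same open subset. The series of derivatives have the same format as this last series, except that for the $n$-th derivative the outer sum is over the set $D-n=\{\alpha-n:\alpha\in D\}$ and the inner sum has new coefficients in $\mathbb{C}$.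
   Context: $\mathbb{C}^\times=\mathbb{C}\setminus\{0\}$. For $z\in\mathbb{C}^\times$, $\log z=\log|z|+i\arg z$ with $0\le\arg z<2\pi$, and $z^\alpha=e^{\alpha\log z}$. Derivatives of the terms are computed by the usual rules $\frac{d}{dz}\log z=z^{-1}$, $\frac{d}{dz}z^\alpha=\alpha z^{\alpha-1}$ (also at points of the positive real axis). Absolute convergence on a set means absolute convergence at each point of it; in the second series each term indexed by $\alpha$ (the whole finite inner sum times $z^\alpha$) is a single term. *)

(* Defs.v *)
From mathcomp Require Import all_boot all_order all_algebra.
From mathcomp Require Import all_classical all_reals all_analysis.
From mathcomp Require Import complex ring lra.

Set Implicit Arguments.
Unset Strict Implicit.
Unset Printing Implicit Defensive.

Import Order.TTheory GRing.Theory Num.Theory.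
Import numFieldNormedType.Exports.
Import ComplexField.Normc.

Local Open Scope ring_scope.
Local Open Scope complex_scope.

Section ComplexFunctions.
Variable R : realType.
Implicit Types (z w : R[i]) (t : R).

Definition cis t : R[i] := cos t +i* sin t.

Definition cexp z : R[i] := (expR (complex.Re z))%:C * cis (complex.Im z).

(* The argument in [0, 2 pi[ ; its value at 0 is irrelevant. *)
Definition carg z : R :=
  if 0 <= complex.Im z then acos (complex.Re z / normc z)
  else pi *+ 2 - acos (complex.Re z / normc z).

Definition clog z : R[i] := ln (normc z) +i* carg z.

Definition cpow z (alpha : R) : R[i] := cexp (alpha%:C * clog z).

Lemma cargP z : z != 0 ->
  0 <= carg z < pi *+ 2 /\ z = (normc z)%:C * cis (carg z).
Proof.
case: z => x y z0.
have npos : 0 < normc (x +i* y).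
  rewrite lt_neqAle sqrtr_ge0 andbT eq_sym.
  by apply: contra z0 => /eqP/eq0_normc ->.
set r := normc _ in npos *.
have r2 : r ^+ 2 = x ^+ 2 + y ^+ 2 by rewrite sqr_sqrtr ?addr_ge0 ?sqr_ge0.
have u1 : (x / r) ^+ 2 <= 1.
  by rewrite expr_div_n ler_pdivrMr ?exprn_gt0// mul1r r2 lerDl sqr_ge0.
have u : -1 <= x / r <= 1.
  by rewrite -ler_norml -(@ler_pXn2r _ 2) ?nnegrE// real_normK ?num_real// expr1n.
have sn : sin (acos (x / r)) = `|y| / r.
  rewrite sin_acos//.
  have -> : 1 - (x / r) ^+ 2 = (`|y| / r) ^+ 2.
    rewrite !expr_div_n real_normK ?num_real//.
    have -> : y ^+ 2 = r ^+ 2 - x ^+ 2 by rewrite r2; ring.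
    by field; rewrite gt_eqF.
  by rewrite sqrtr_sqr ger0_norm// divr_ge0// ltW.
have rn0 : r != 0 by rewrite gt_eqF.
have p0 := @pi_gt0 R.
rewrite /carg /cis -/r /=; have [y0|y0] := leP 0 y.
  split.
    rewrite acos_ge0//=; apply: le_lt_trans (acos_lepi u) _.
    by rewrite mulr2n ltrDl.
  rewrite acosK ?in_itv//= sn ger0_norm//.
  by apply/eqP; rewrite eq_complex /= !mul0r subr0 addr0 !(mulrC r) !divfK// !eqxx.
have a0 : 0 < acos (x / r).
  rewrite lt_neqAle acos_ge0// andbT eq_sym; apply/eqP => h.
  move: sn; rewrite h sin0 => /esym/eqP.
  by rewrite mulf_eq0 invr_eq0 (negPf rn0) orbF normr_eq0 lt_eqF.
split.
  have := acos_lepi u => h; apply/andP; split; [rewrite mulr2n|]; lra.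
rewrite cosB sinB cos2pi.
rewrite sin2pi acosK ?in_itv//= sn ltr0_norm//.
by apply/eqP; rewrite eq_complex /=; apply/andP; split; apply/eqP; field.
Qed.

(* Absolute convergence of a family indexed by an arbitrary set D: the finite
   partial sums of the moduli are bounded. *)
Definition abs_convergent (D : set R) (f : R -> R[i]) : Prop :=
  summable D (fun alpha => (normc (f alpha))%:E).

End ComplexFunctions.

(* Formal expressions in log z and z^alpha.  They carry the derivatives that
   are computed by the usual rules at every point of C \ {0}, including the
   positive real axis, where the functions log z and z^alpha jump. *)
Inductive expr (R : realType) : Type :=
| EConst of R[i]
| ELog
| EPow of R
| EAdd of expr R & expr R
| EMul of expr R & expr R
| EExp of expr R & nat.

Arguments ELog {R}.

Section Expressions.
Variable R : realType.
Implicit Types (e : expr R) (z : R[i]).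

Fixpoint eeval e z : R[i] :=
  match e with
  | EConst c => c
  | ELog => clog z
  | EPow alpha => cpow z alpha
  | EAdd e1 e2 => eeval e1 z + eeval e2 z
  | EMul e1 e2 => eeval e1 z * eeval e2 z
  | EExp e1 n => eeval e1 z ^+ n
  end.

Fixpoint ederiv e : expr R :=
  match e with
  | EConst _ => EConst 0
  | ELog => EPow (-1)
  | EPow alpha => EMul (EConst alpha%:C) (EPow (alpha - 1))
  | EAdd e1 e2 => EAdd (ederiv e1) (ederiv e2)
  | EMul e1 e2 => EAdd (EMul (ederiv e1) e2) (EMul e1 (ederiv e2))
  | EExp e1 n => EMul (EMul (EConst n%:R) (EExp e1 n.-1)) (ederiv e1)
  end.

Definition nderiv (n : nat) e : expr R := iter n ederiv e.

Definition log_term (N : nat) (c : 'I_N.+1 -> R[i]) (alpha : R) : expr R :=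
  EMul (\big[@EAdd R/EConst 0]_(beta < N.+1)
          EMul (EConst (c beta)) (EExp ELog beta))
       (EPow alpha).

Lemma eeval_log_term (N : nat) (c : 'I_N.+1 -> R[i]) (alpha : R) z :
  eeval (log_term c alpha) z =
  (\sum_(beta < N.+1) c beta * clog z ^+ beta) * cpow z alpha.
Proof.
rewrite /log_term /=; congr (_ * _).
exact: (big_morph (fun e => eeval e z)).
Qed.

End Expressions.

(* Main.v *)
(* Since |z^alpha| depends only on |z|, absolute convergence of the series with
   coefficients a_(alpha, beta) is a condition on |z|.  In one direction, the n-th
   derivative of P(log z) z^alpha is Q(log z) z^(alpha - n), where Q arises from P
   by iterating P |-> P' + g P, so its coefficients are O((1 + |alpha|)^n) times
   those of P; this factor is absorbed by the slightly larger and slightly smaller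
   moduli available in the open set.  Conversely, already the undifferentiated
   series suffices: evaluating it at N + 1 points of equal modulus and inverting a
   Vandermonde matrix in their logarithms bounds every |a_(alpha, beta)|. *)

Require Import Defs.
From mathcomp Require Import all_boot all_order all_algebra.
From mathcomp Require Import all_classical all_reals all_analysis.
From mathcomp Require Import complex.
From mathcomp Require Import ring lra.
Set Implicit Arguments.
Unset Strict Implicit.
Unset Printing Implicit Defensive.

Import Order.TTheory GRing.Theory Num.Theory.
Import numFieldNormedType.Exports.
Import ComplexField.Normc.
Local Open Scope classical_set_scope.
Local Open Scope ring_scope.
Local Open Scope complex_scope.

(** * Moduli and comparison of absolutely convergent families *)

Lemma normc_ge0 (R : realType) (z : R[i]) : 0 <= normc z.
Proof. by case: z => x y; exact: sqrtr_ge0. Qed.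

Lemma normc_gt0 (R : realType) (z : R[i]) : z != 0 -> 0 < normc z.
Proof.
by move=> z0; rewrite lt0r normc_ge0 andbT; apply: contra z0 => /eqP/eq0_normc ->.
Qed.

Lemma normc_real (R : realType) (x : R) : normc x%:C = `|x|.
Proof. by rewrite /normc /= expr0n /= addr0 sqrtr_sqr. Qed.

Lemma normcX (R : realType) (z : R[i]) n : normc (z ^+ n) = normc z ^+ n.
Proof. by elim: n => [|n IHn]; rewrite ?expr0 ?normc1// !exprS normcM IHn. Qed.

Lemma normc_natM (R : realType) (z : R[i]) n : normc (z *+ n) = normc z *+ n.
Proof. exact: normcMn. Qed.

Lemma normcD_le (R : realType) (z w : R[i]) : normc (z + w) <= normc z + normc w.
Proof. exact: le_normcD. Qed.

Lemma normc_sum (R : realType) (I : finType) (f : I -> R[i]) :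
  normc (\sum_i f i) <= \sum_i normc (f i).
Proof.
apply: (big_ind2 (fun u v => normc u <= v)) => [|x x' y y' hx hy|//].
  by rewrite normc0.
apply: le_trans (lerD hx hy). exact: normcD_le.
Qed.

Lemma normc_ReIm (R : realType) (z : R[i]) :
  normc z <= `|complex.Re z| + `|complex.Im z|.
Proof.
case: z => x y /=; rewrite -[leRHS]ger0_norm ?addr_ge0// -sqrtr_sqr ler_wsqrtr//.
rewrite sqrrD !real_normK ?num_real// -addrA lerD2l lerDr.
by rewrite mulrn_wge0// mulr_ge0.
Qed.

(* Bounding the constant by an integer turns the scaled finite sum into a plain
   finite sum. *)
Lemma abs_convergent_le (R : realType) (I : finType) (D : set R)
    (f : R -> R[i]) (g : I -> R -> R[i]) (C : R) :
  (forall i, abs_convergent D (g i)) ->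
  (forall alpha, D alpha -> normc (f alpha) <= C * \sum_i normc (g i alpha)) ->
  abs_convergent D f.
Proof.
move=> gD fg; rewrite /abs_convergent /summable.
have [m Cm] : exists m : nat, C <= m%:R.
  by exists (Num.truncn C).+1; rewrite ltW// truncnS_gt.
apply: (@le_lt_trans _ _ (\esum_(alpha in D)
    \sum_(p : 'I_m * I) (normc (g p.2 alpha))%:E)%E).
  apply: le_esum => alpha Dalpha.
  rewrite gee0_abs ?lee_fin ?normc_ge0// sumEFin lee_fin.
  apply: (le_trans (fg _ Dalpha)).
  rewrite -(pair_big xpredT xpredT (fun _ i => normc (g i alpha))) /=.
  rewrite sumr_const card_ord -mulr_natl ler_wpM2r// sumr_ge0// => i _.
  exact: normc_ge0.
rewrite esum_sum => [|alpha p _ _]; last by rewrite lee_fin normc_ge0.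
apply: lte_sum_pinfty => p _; apply: le_lt_trans (gD p.2).
by apply: le_esum => alpha _; rewrite gee0_abs// lee_fin normc_ge0.
Qed.

(** * Complex exponential, powers and logarithm *)

Lemma cisD (R : realType) (s t : R) : cis (s + t) = cis s * cis t.
Proof.
apply/eqP; rewrite eq_complex /= cosD sinD (addrC (sin s * _)).
by rewrite !eqxx.
Qed.

Lemma normc_cis (R : realType) (t : R) : normc (cis t) = 1.
Proof. by rewrite /cis /= cos2Dsin2 sqrtr1. Qed.

Lemma cexpD (R : realType) (z w : R[i]) : cexp (z + w) = cexp z * cexp w.
Proof.
case: z w => [x y] [u v]; rewrite /cexp /= expRD cisD.
by rewrite rmorphM /= mulrACA.
Qed.

Lemma cpow0 (R : realType) (z : R[i]) : cpow z 0 = 1.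
Proof.
rewrite /cpow mul0r /cexp /= expR0 /cis cos0 sin0 mul1r.
by apply/eqP; rewrite eq_complex /= !eqxx.
Qed.

Lemma cpowD (R : realType) (z : R[i]) (s t : R) :
  cpow z (s + t) = cpow z s * cpow z t.
Proof. by rewrite /cpow rmorphD mulrDl cexpD. Qed.

(** Since the exponent is real, the argument of [z] contributes only a phase. *)
Lemma normc_cpow (R : realType) (z : R[i]) (s : R) :
  normc (cpow z s) = expR (s * ln (normc z)).
Proof.
rewrite /cpow /cexp normcM normc_cis mulr1 normc_real ger0_norm ?expR_ge0//.
by rewrite /= mul0r subr0.
Qed.

Lemma clog_inj (R : realType) (z w : R[i]) :
  z != 0 -> w != 0 -> clog z = clog w -> z = w.
Proof.
move=> z0 w0 /eqP; rewrite eq_complex /= => /andP[/eqP lzw /eqP azw].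
have [_ ->] := cargP z0; have [_ ->] := cargP w0.
by rewrite azw (ln_inj _ _ lzw) ?posrE ?normc_gt0.
Qed.

(** * Derivatives as operators on polynomials in the logarithm *)

(** This is the effect on [p] of differentiating p(log z) z^g once a factor z^(g - 1) is taken
    out. *)
Definition log_deriv (R : realType) (g : R) (p : {poly R[i]}) : {poly R[i]} :=
  p^`() + g%:C *: p.

(** After n' derivatives the exponent has dropped to g - n', so the operator changes at each
    step. *)
Fixpoint log_nderiv (R : realType) (g : R) (n : nat) (p : {poly R[i]})
    : {poly R[i]} :=
  if n is n'.+1 then log_deriv (g - n'%:R) (log_nderiv g n' p) else p.

(* The formal expression stands for [p (log z) z^g]. *)
Inductive represents (R : realType) : expr R -> {poly R[i]} -> R -> Prop :=
| Rep0 g : represents (EConst 0) 0 g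
| RepConst c : represents (EConst c) c%:P 0
| RepLog : represents ELog 'X 0
| RepPow g : represents (EPow g) 1 g
| RepAdd e1 e2 p1 p2 p g : represents e1 p1 g -> represents e2 p2 g ->
    p = p1 + p2 -> represents (EAdd e1 e2) p g
| RepMul e1 e2 p1 p2 p g1 g2 g : represents e1 p1 g1 -> represents e2 p2 g2 ->
    p = p1 * p2 -> g = g1 + g2 -> represents (EMul e1 e2) p g
| RepExp e q p n : represents e q 0 -> p = q ^+ n ->
    represents (EExp e n) p 0.

Lemma eeval_represents (R : realType) (e : expr R) p g z :
  represents e p g -> eeval e z = p.[clog z] * cpow z g.
Proof.
elim=> {e p g} /=.
- by move=> g; rewrite horner0 mul0r.
- by move=> c; rewrite hornerC cpow0 mulr1.
- by rewrite hornerX cpow0 mulr1.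
- by move=> g; rewrite -polyC1 hornerC mul1r.
- by move=> e1 e2 p1 p2 _ g _ -> _ -> ->; rewrite hornerD mulrDl.
- by move=> e1 e2 p1 p2 _ g1 g2 _ _ -> _ -> -> ->; rewrite hornerM cpowD mulrACA.
- by move=> e q _ n _ -> ->; rewrite horner_exp cpow0 !mulr1.
Qed.

Lemma represents_ederiv (R : realType) (e : expr R) p g :
  represents e p g -> represents (ederiv e) (log_deriv g p) (g - 1).
Proof.
rewrite /log_deriv; elim=> {e p g} /=.
- by move=> g; rewrite deriv0 scaler0 addr0; exact: Rep0.
(* The derivative of a constant must be placed at exponent -1; this is why [Rep0] leaves the
   exponent of zero free. *)
- by move=> c; rewrite derivC scale0r addr0; exact: Rep0.
- by rewrite derivX scale0r addr0 sub0r; exact: RepPow.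
- move=> g; rewrite derivC add0r.
  by apply: RepMul (RepConst _) (RepPow _) _ _; rewrite ?add0r// alg_polyC mulr1.
- move=> e1 e2 p1 p2 _ g _ h1 _ h2 ->; apply: RepAdd h1 h2 _.
  by rewrite derivD scalerDr addrACA.
- move=> e1 e2 p1 p2 _ g1 g2 _ r1 h1 r2 h2 -> ->.
  apply: RepAdd.
  + by apply: RepMul h1 r2 _ _; [reflexivity|ring].
  + by apply: RepMul r1 h2 _ _; [reflexivity|ring].
  (* Leibniz rule: the scalar g1 + g2 is shared out between the two summands. *)
  + rewrite derivM rmorphD scalerDl -!mul_polyC; ring.
(* At exponent 0 the operator is the ordinary derivative, so the chain rule for powers applies. *)
- move=> e q _ n r + ->; rewrite !scale0r !addr0 => h.
  apply: RepMul.
  + exact: RepMul (RepConst _) (RepExp r erefl) erefl erefl.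
  + exact: h.
  + by rewrite deriv_exp polyCMn polyC1 mulr_natl mulrnAl mulrC.
  + by rewrite !add0r.
Qed.

Lemma represents_nderiv (R : realType) (e : expr R) p g n :
  represents e p g -> represents (nderiv n e) (log_nderiv g n p) (g - n%:R).
Proof.
move=> ep; elim: n => [|n IHn] /=; first by rewrite subr0.
by rewrite -natr1 opprD addrA; exact: represents_ederiv.
Qed.

Definition log_poly (R : realType) {N : nat} (c : 'I_N.+1 -> R[i]) : {poly R[i]} :=
  \poly_(i < N.+1) c (inord i).

Lemma represents_log_term (R : realType) (N : nat) (c : 'I_N.+1 -> R[i]) g :
  represents (log_term c g) (log_poly c) g.
Proof.
apply: (@RepMul _ _ _ (log_poly c) 1 _ 0 g); last 2 first.
- by rewrite mulr1.
- by rewrite add0r.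
- rewrite /log_poly poly_def.
  apply: (big_ind2 (fun e p => represents e p 0)).
  + exact: Rep0.
  + by move=> e1 p1 e2 p2 r1 r2; exact: RepAdd r1 r2 erefl.
  + move=> i _; rewrite inord_val.
    apply: RepMul (RepConst _) (RepExp (RepLog _) erefl) _ _; last by rewrite add0r.
    by rewrite mul_polyC.
- exact: RepPow.
Qed.

Lemma eeval_nderiv_log_term (R : realType) (N : nat) (c : 'I_N.+1 -> R[i]) g n z :
  eeval (nderiv n (log_term c g)) z =
  (log_nderiv g n (log_poly c)).[clog z] * cpow z (g - n%:R).
Proof. exact/eeval_represents/represents_nderiv/represents_log_term. Qed.

Lemma size_log_nderiv (R : realType) g n (p : {poly R[i]}) :
  (size (log_nderiv g n p) <= size p)%N.
Proof.
elim: n => [//|n IHn] /=; apply: leq_trans IHn.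
rewrite (leq_trans (size_polyD _ _))// geq_max size_scale_leq andbT.
by rewrite /deriv (leq_trans (size_poly _ _))// leq_pred.
Qed.

(** * Growth estimates for coefficients and exponentials *)

Definition coef_norm (R : realType) (N : nat) (p : {poly R[i]}) : R :=
  \sum_(i < N.+1) normc p`_i.

Lemma coef_norm_ge0 (R : realType) N (p : {poly R[i]}) : 0 <= coef_norm N p.
Proof. by apply: sumr_ge0 => i _; exact: normc_ge0. Qed.

Lemma coef_norm_log_poly (R : realType) N (c : 'I_N.+1 -> R[i]) :
  coef_norm N (log_poly c) = \sum_i normc (c i).
Proof. by apply: eq_bigr => i _; rewrite coef_poly ltn_ord inord_val. Qed.

(** Differentiation shifts the coefficients and multiplies each by at most N + 1; the scalar term
    contributes |g|. *)
Lemma coef_norm_log_deriv (R : realType) N g (p : {poly R[i]}) :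
  (size p <= N.+1)%N ->
  coef_norm N (log_deriv g p) <= (N.+1%:R + `|g|) * coef_norm N p.
Proof.
move=> sp.
(* The shift brings in only the coefficient of index N + 1, which vanishes by the size bound. *)
have shift : \sum_(i < N.+1) normc p`_i.+1 <= coef_norm N p.
  have : \sum_(i < N.+2) normc p`_i = coef_norm N p.
    by rewrite big_ord_recr /= nth_default// normc0 addr0.
  by rewrite big_ord_recl => <-; rewrite lerDr normc_ge0.
rewrite mulrDl; apply: le_trans (lerD (ler_wpM2l (ler0n _ _) shift) (lexx _)).
rewrite !mulr_sumr -big_split /=; apply: ler_sum => i _.
rewrite coefD coefZ coef_deriv (le_trans (normcD_le _ _))//.
rewrite normcM normc_real normc_natM lerD2r -[in leLHS]mulr_natl.
by rewrite ler_wpM2r ?normc_ge0// ler_nat.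
Qed.

(** Each step k < n costs a factor N + 1 + |g - k|. The separate bound [m] keeps the base of the
    power fixed during the induction on [n]. *)
Lemma coef_norm_log_nderiv (R : realType) N g n m (p : {poly R[i]}) :
  (size p <= N.+1)%N -> (n <= m)%N ->
  coef_norm N (log_nderiv g n p) <= (N.+1%:R + m%:R + `|g|) ^+ n * coef_norm N p.
Proof.
move=> sp; elim: n => [|n IHn] nm /=; first by rewrite mul1r.
apply: le_trans (coef_norm_log_deriv _ _) _.
  exact: leq_trans (size_log_nderiv _ _ _) sp.
rewrite exprS -mulrA ler_pM ?addr_ge0 ?coef_norm_ge0 ?IHn// 1?ltnW//.
have := ler_normB g n%:R; rewrite normr_nat.
by have : n%:R <= m%:R :> R; [rewrite ler_nat ltnW|lra].
Qed.

Lemma normc_horner_le (R : realType) N (p : {poly R[i]}) x :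
  (size p <= N.+1)%N -> normc p.[x] <= coef_norm N p * (1 + normc x) ^+ N.
Proof.
move=> sp; rewrite (horner_coef_wide _ sp) (le_trans (normc_sum _))//.
rewrite mulr_suml; apply: ler_sum => i _.
rewrite normcM normcX ler_wpM2l ?normc_ge0//.
have x1 : 1 <= 1 + normc x by rewrite lerDl normc_ge0.
apply: (@le_trans _ _ ((1 + normc x) ^+ i)); last by rewrite ler_weXn2l// -ltnS.
by rewrite lerXn2r ?nnegrE ?normc_ge0 ?lerDr ?(le_trans ler01 x1).
Qed.

Lemma exprn_le_expR (R : realType) (x : R) n : 0 <= x -> x ^+ n <= n`!%:R * expR x.
Proof.
move=> x0; case: n => [|n].
  by rewrite fact0 mul1r expr0 (le_trans _ (expR_ge1Dx _))// lerDl.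
rewrite mulrC -ler_pdivrMr ?ltr0n ?fact_gt0//.
by apply: le_trans (expR_ge1Dxn n x0); rewrite lerDr.
Qed.

(** Apply y^n <= n! e^y to y = d (K + |x|). Whatever the sign of x, e^(d |x|) is one of the two
    exponentials on the right. *)
Lemma exprn_le_expR_pm (R : realType) (d K : R) n : 0 < d -> 0 <= K ->
  exists2 C, 0 <= C & forall x,
    (K + `|x|) ^+ n <= C * (expR (d * x) + expR (- d * x)).
Proof.
move=> d0 K0; exists (n`!%:R * expR (d * K) / d ^+ n).
  by rewrite divr_ge0 ?exprn_ge0 ?(ltW d0)// mulr_ge0 ?expR_ge0.
move=> x; rewrite mulrAC ler_pdivlMr ?exprn_gt0// mulrC -exprMn.
apply: le_trans (exprn_le_expR _ _) _; first by rewrite mulr_ge0 ?addr_ge0// ltW.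
rewrite mulrDr expRD mulrA ler_wpM2l ?mulr_ge0 ?expR_ge0//.
by case: (ger0P x) => _; rewrite ?mulrN -?mulNr ?lerDl ?lerDr expR_ge0.
Qed.

(** * Small motions inside an open set and the first implication *)

Lemma open_normc (R : realType) (U : set R[i]^o) z : open U -> U z ->
  exists2 r : R, 0 < r & forall w, normc (w - z) < r -> U w.
Proof.
move=> oU Uz; have /nbhs_ballP[e /= e0 eU] := open_nbhs_nbhs (conj oU Uz).
(* The radius of a ball is a complex number here; being positive, it has imaginary part 0. *)
case: e e0 eU => r s; rewrite ltcE /= => /andP[/eqP -> r0] rU.
exists r => // w wr; apply: rU; rewrite -ball_normE /= distrC.
by rewrite [X in X < _]/(_%:C) ltcR.
Qed.

(** A continuous path of multipliers starting at 1 covers both dilations and rotations. *)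
Lemma open_path (R : realType) (U : set R[i]^o) z (f g : R -> R) :
  open U -> U z -> continuous f -> continuous g -> f 0 = 1 -> g 0 = 0 ->
  exists2 d, 0 < d & forall t, `|t| < d -> U (z * (f t +i* g t)).
Proof.
move=> oU Uz cf cg f0 g0; have [r r0 rU] := open_normc oU Uz.
(* Two coordinate errors below [e] move z by at most 2 e |z| < r; the added 1 keeps the denominator
   positive when z = 0. *)
pose e := r / (2 * (1 + normc z)).
have z1 : 0 < 1 + normc z by rewrite ltr_pwDl// normc_ge0.
have e0 : 0 < e by rewrite divr_gt0// mulr_gt0.
have /cvgrPdist_lt/(_ e e0) nf := cf 0; have /cvgrPdist_lt/(_ e e0) ng := cg 0.
have [d /= d0 dfg] := (@nbhs_ballP _ _ (0 : R^o) _).1 (filterI nf ng).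
exists d => // t td; apply: rU.
have [] : `|f 0 - f t| < e /\ `|g 0 - g t| < e.
  by apply: dfg; rewrite -ball_normE /= sub0r normrN.
rewrite f0 g0 sub0r normrN distrC => ft gt.
have -> : z * (f t +i* g t) - z = z * ((f t - 1) +i* g t).
  rewrite -[X in _ - X]mulr1 -mulrBr; congr (_ * _).
  by apply/eqP; rewrite eq_complex /= subr0 !eqxx.
rewrite normcM; apply: (@le_lt_trans _ _ (normc z * (e + e))).
  rewrite ler_wpM2l ?normc_ge0// (le_trans (normc_ReIm _))//.
  by rewrite lerD// ltW.
have -> : normc z * (e + e) = r * (normc z / (1 + normc z)).
  by rewrite /e; field; rewrite gt_eqF.
by rewrite gtr_pMr// ltr_pdivrMr// mul1r ltrDr.
Qed.

Lemma open_dilation (R : realType) (U : set R[i]^o) z : open U -> U z ->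
  exists2 d : R, 0 < d & U (z * (expR d)%:C) /\ U (z * (expR (- d))%:C).
Proof.
move=> oU Uz.
have [d d0 dU] := open_path oU Uz (@continuous_expR R)
  (@cst_continuous _ _ 0) (@expR0 R) erefl.
exists (d / 2); first by rewrite divr_gt0.
by split; apply: dU; rewrite ?normrN gtr0_norm ?divr_gt0//; lra.
Qed.

Lemma ln_normc_dilation (R : realType) (z : R[i]) (d : R) : z != 0 ->
  ln (normc (z * (expR d)%:C)) = ln (normc z) + d.
Proof.
move=> z0; rewrite normcM normc_real ger0_norm ?expR_ge0//.
by rewrite lnM ?posrE ?expR_gt0 ?normc_gt0// expRK.
Qed.

(* A factor [|alpha|^n] is absorbed by moving [|z|] slightly outwards and
   inwards inside the open set. *)
Lemma abs_convergent_nderiv (R : realType) (D : set R) N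
    (a : R -> 'I_N.+1 -> R[i]) (U : set R[i]^o) :
  open U -> (forall z, U z -> z != 0) ->
  (forall beta z, U z ->
    abs_convergent D (fun alpha => a alpha beta * cpow z alpha)) ->
  forall n z, U z ->
    abs_convergent D (fun alpha => eeval (nderiv n (log_term (a alpha) alpha)) z).
Proof.
move=> oU U0 aU n z Uz; have z0 := U0 z Uz.
have [d d0 [Up Um]] := open_dilation oU Uz.
(* The offset N + 1 + n is the one in [coef_norm_log_nderiv] with m = n. *)
have [C C0 hC] := exprn_le_expR_pm n d0
  (addr_ge0 (ler0n R N.+1) (ler0n R n)).
pose w (s : bool) := z * (expR (if s then d else - d))%:C.
pose L := ln (normc z); pose M := (1 + normc (clog z)) ^+ N.
(* The dominating series are those of all coefficients at both dilated points. [C] absorbs the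
   growth in alpha, [M] the powers of [clog z], and the last factor is |z|^(-n). *)
apply: (@abs_convergent_le _ (bool * 'I_N.+1)%type D _
  (fun p alpha => a alpha p.2 * cpow (w p.1) alpha) (C * M * expR (- n%:R * L))).
  by move=> [[] beta]; exact: aU.
move=> alpha _; rewrite eeval_nderiv_log_term normcM normc_cpow -/L mulrDl expRD.
have -> : \sum_p normc (a alpha p.2 * cpow (w p.1) alpha) =
    (\sum_i normc (a alpha i)) * (expR (d * alpha) + expR (- d * alpha)) *
    expR (alpha * L).
  rewrite -(pair_big xpredT xpredT
    (fun s i => normc (a alpha i * cpow (w s) alpha))) /=.
  rewrite big_bool /= -mulrA mulrDl mulrDr; congr (_ + _);
    rewrite mulr_suml; apply: eq_bigr => i _;
    rewrite normcM normc_cpow ln_normc_dilation// -expRD -/L;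
    by congr (_ * expR _); ring.
have sP : (size (log_poly (a alpha)) <= N.+1)%N by exact: size_poly.
set A := \sum_i _; set E := _ + _.
have hor : normc (log_nderiv alpha n (log_poly (a alpha))).[clog z] <= C * E * A * M.
  apply: le_trans (normc_horner_le _ (leq_trans (size_log_nderiv _ _ _) sP)) _.
  rewrite ler_wpM2r ?exprn_ge0 ?addr_ge0 ?normc_ge0//.
  apply: le_trans (coef_norm_log_nderiv _ sP (leqnn n)) _.
  by rewrite coef_norm_log_poly -/A ler_wpM2r// -[A]coef_norm_log_poly coef_norm_ge0.
have -> : C * M * expR (- n%:R * L) * (A * E * expR (alpha * L)) =
  (C * E * A * M) * (expR (alpha * L) * expR (- n%:R * L)) by ring.
by rewrite ler_wpM2r// mulr_ge0 ?expR_ge0.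
Qed.

(** * Interpolation and the converse implication *)

(** Distinct nodes make the Vandermonde matrix invertible. The constant, the sum of the moduli of
    all entries of the inverse, depends only on the nodes and so serves every alpha at once. *)
Lemma coef_le_horner (R : realType) N (x : 'I_N.+1 -> R[i]) : injective x ->
  exists C : R, forall p : {poly R[i]}, (size p <= N.+1)%N ->
    forall i : 'I_N.+1, normc p`_i <= C * \sum_j normc p.[x j].
Proof.
move=> xI; pose V := Vandermonde N.+1 (\row_j x j).
have Vu : V \in unitmx.
  rewrite unitmxE det_Vandermonde unitfE; apply/prodf_neq0 => i _.
  apply/prodf_neq0 => j ij; rewrite !mxE subr_eq0.
  by apply: contraTneq ij => /xI ->; rewrite ltnn.
pose W := invmx V; exists (\sum_j \sum_i normc (W j i)) => p sp i.
have pV : (\row_j p.[x j]) *m W = \row_i p`_i.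
  rewrite -[RHS](mulmxK Vu); congr (_ *m _); apply/rowP => j; rewrite !mxE.
  rewrite (horner_coef_wide _ sp); apply: eq_bigr => k _.
  by rewrite !mxE.
have -> : p`_i = ((\row_j p.[x j]) *m W) ord0 i by rewrite pV mxE.
rewrite mxE (le_trans (normc_sum _))// mulr_sumr; apply: ler_sum => j _.
rewrite mxE normcM mulrC ler_wpM2r ?normc_ge0//.
rewrite (bigD1 j)//= (bigD1 i)//= -addrA lerDl addr_ge0//.
  by rewrite sumr_ge0// => k _; exact: normc_ge0.
by rewrite sumr_ge0// => k _; rewrite sumr_ge0// => l _; exact: normc_ge0.
Qed.

Lemma open_rotation (R : realType) (U : set R[i]^o) z N :
  open U -> U z -> z != 0 ->
  exists2 w : 'I_N -> R[i], injective w &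
    forall j, U (w j) /\ normc (w j) = normc z.
Proof.
move=> oU Uz z0.
have [d d0 dU] := open_path oU Uz (@continuous_cos R) (@continuous_sin R)
  (@cos0 R) (@sin0 R).
(* The cap 1 keeps all angles in [0, pi], where the cosine is injective; real parts then separate
   the rotated points. *)
pose e := Num.min d 1.
have e0 : 0 < e by rewrite lt_min d0 ltr01.
pose t (j : 'I_N) : R := e * (j%:R / N%:R).
have t_ge0 j : 0 <= t j by rewrite mulr_ge0 ?divr_ge0// ltW.
have t_lt j : t j < e.
  rewrite gtr_pMr// ltr_pdivrMr ?mul1r ?ltr_nat//.
  by rewrite ltr0n (leq_ltn_trans _ (ltn_ord j)).
have t_pi j : t j \in `[0, pi].
  rewrite in_itv /= t_ge0 (le_trans (ltW (t_lt j)))// ge_min.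
  by apply/orP; right; apply: le_trans (@pi_ge2 R); rewrite ler1n.
exists (fun j => z * cis (t j)).
  move=> i j /(mulfI z0) /(congr1 (@complex.Re R)) /= /(cos_inj (t_pi i) (t_pi j)).
  move=> /(mulfI (lt0r_neq0 e0)) /mulIf; rewrite invr_eq0 pnatr_eq0 -lt0n.
  move=> /(_ (leq_ltn_trans (leq0n _) (ltn_ord i))) /eqP.
  by rewrite eqr_nat => /eqP/val_inj.
move=> j; rewrite normcM normc_cis mulr1; split=> //; apply: dU.
by rewrite ger0_norm// (lt_le_trans (t_lt j))// ge_min lexx.
Qed.

(* The coefficients are recovered by interpolation at [N + 1] points of the same
   modulus, on which all the [|z^alpha|] agree. *)
Lemma abs_convergent_coef (R : realType) (D : set R) N
    (a : R -> 'I_N.+1 -> R[i]) (U : set R[i]^o) :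
  open U -> (forall z, U z -> z != 0) ->
  (forall z, U z ->
    abs_convergent D (fun alpha => eeval (log_term (a alpha) alpha) z)) ->
  forall beta z, U z ->
    abs_convergent D (fun alpha => a alpha beta * cpow z alpha).
Proof.
move=> oU U0 aU beta z Uz.
have [w wI wU] := open_rotation N.+1 oU Uz (U0 z Uz).
(* The interpolation nodes are the logarithms, which stay distinct because a nonzero number is
   determined by its logarithm. *)
have lwI : injective (fun j => clog (w j)).
  by move=> i j /clog_inj/wI; apply; apply: U0; apply wU.
have [C hC] := coef_le_horner lwI.
apply: (@abs_convergent_le _ 'I_N.+1 D _
  (fun j alpha => eeval (log_term (a alpha) alpha) (w j)) C).
  by move=> j; apply: aU; apply wU.
move=> alpha _; rewrite normcM.
under eq_bigr => j _ do
  rewrite (eeval_represents _ (represents_log_term _ _)) normcM normc_cpow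
    (wU j).2 -normc_cpow.
rewrite -mulr_suml mulrA ler_wpM2r ?normc_ge0//.
have := hC (log_poly (a alpha)) (size_poly _ _) beta.
by rewrite coef_poly ltn_ord inord_val.
Qed.

Theorem proposition7p9 (R : realType) (D : set R) (N : nat)
    (a : R -> 'I_N.+1 -> R[i]) :
  (forall U : set R[i]^o,
     open U -> U !=set0 -> (forall z, U z -> z != 0) ->
     ((forall beta : 'I_N.+1, forall z, U z ->
         abs_convergent D (fun alpha => a alpha beta * cpow z alpha))
      <->
      (forall n : nat, forall z, U z ->
         abs_convergent D
           (fun alpha => eeval (nderiv n (log_term (a alpha) alpha)) z))))
  /\
  (forall n : nat, exists b : R -> 'I_N.+1 -> R[i],
     forall gamma : R, [set alpha - n%:R | alpha in D] gamma ->
     forall z : R[i], z != 0 ->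
       eeval (nderiv n (log_term (a (gamma + n%:R)) (gamma + n%:R))) z =
       (\sum_(beta < N.+1) b gamma beta * clog z ^+ beta) * cpow z gamma).
Proof.
split=> [U oU _ U0|n].
  split=> [aU|aU]; first exact: abs_convergent_nderiv.
  exact: abs_convergent_coef (aU 0%N).
(* With alpha = gamma + n, the new coefficients are those of the iterated polynomial, whose size is
   still at most N + 1. *)
exists (fun gamma beta =>
  (log_nderiv (gamma + n%:R) n (log_poly (a (gamma + n%:R))))`_beta).
move=> gamma _ z _; rewrite eeval_nderiv_log_term addrK.
rewrite (horner_coef_wide _ (leq_trans (size_log_nderiv _ _ _) (size_poly _ _))).
by [].
Qed.
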